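(* Let $G$ be a group and let $H$ and $K$ be two strongly commensurable and almost normal subgroups of $G$. Suppose $L$ is a length function on $G$ such that $H\subseteq N_L$ and $K\subseteq N_L$. Then the Hecke pair $(G,H)$ has (RD) with respect to $L$ if and only if the Hecke pair $(G,K)$ has (RD) with respect to $L$.
   Context: All groups are discrete. Two subgroups $H,K$ of a group $G$ are strongly commensurable if $H\cap K$ has finite index in both $H$ and $K$. A subgroup $H\leq G$ is almost normal if every double coset $HgH$ ($g\in G$) is a union of finitely many left cosets of $H$; then $(G,H)$ is called a Hecke pair. A length function on $G$ is a map $L:G\to[0,\infty)$ with $L(1)=0$, $L(g^{-1})=L(g)$ and $L(gh)\leq L(g)+L(h)$ for all $g,h\in G$; put $N_L=\{g\in G: L(g)=0\}$. A length function on a Hecke pair $(G,H)$ is a length function $L$ on $G$ with $H\subseteq N_L$ (so $L$ is constant on double cosets of $H$). $\mathcal{H}(G,H)$ is the space of finitely supported complex functions on the set of double cosets $G//H$, regarded as $H$-bi-invariant functions on $G$; elements of $\ell^2(H\backslash G)$ are regarded as left $H$-invariant functions on $G$. The regular representation $\lambda:\mathcal{H}(G,H)\to\mathcal{B}(\ell^2(H\backslash G))$ is $\lambda(f)(\xi)(g)=(f*\xi)(g)=\sum_{h\in H\backslash G} f(gh^{-1})\xi(h)$ (sum over representatives of right cosets). For $s\geq 0$, $\|f\|_{s,L}=\big(\sum_{g\in H\backslash G}|f(g)|^2(1+L(g))^{2s}\big)^{1/2}$. The Hecke pair $(G,H)$ has property (RD) with respect to a length function $L$ on $(G,H)$ if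 there are $C,s>0$ with $\|\lambda(f)\|\leq C\|f\|_{s,L}$ for all $f\in\mathcal{H}(G,H)$. Equivalently, there is a polynomial $P$ such that $\|f*k\|_2\leq P(r)\|f\|_2\|k\|_2$ for all $r>0$, all non-negative $f\in\mathcal{H}(G,H)$ supported on double cosets $HgH$ with $L(g)\leq r$, and all non-negative finitely supported $k$ on $H\backslash G$ (norms in $\ell^2(H\backslash G)$). *)

(* Defs.v *)
From HB Require Import structures.
From mathcomp Require Import all_boot all_order all_algebra.
From mathcomp Require Import all_classical all_reals all_analysis.
From mathcomp Require Import complex.

Set Implicit Arguments.
Unset Strict Implicit.
Unset Printing Implicit Defensive.

Import Order.TTheory GRing.Theory Num.Theory.

Local Open Scope classical_set_scope.
Local Open Scope ring_scope.

Section Cosets.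
Variable G : groupType.
Implicit Types (A B H K : {pred G}) (g : G).

Definition lcoset H g : set G := [set (g * h)%g | h in [set` H]].

Definition rcoset H g : set G := [set (h * g)%g | h in [set` H]].

Definition dcoset H g : set G :=
  [set (h * g * k)%g | h in [set` H] & k in [set` H]].

(* H \ G *)
Definition rcosets H : set (set G) := range (rcoset H).

Definition coset_repr (c : set G) : G := xget 1%g c.

(* For A a subgroup of B *)
Definition finite_index A B : Prop :=
  finite_set [set lcoset A b | b in [set` B]].

Definition strongly_commensurable H K : Prop :=
  finite_index [predI H & K] H /\ finite_index [predI H & K] K.

Definition almost_normal H : Prop :=
  forall g, exists2 S : set G,
    finite_set S & dcoset H g = \bigcup_(x in S) lcoset H x.

End Cosets.

Section LengthFunctions.
Variables (R : realType) (G : groupType).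
Implicit Type L : G -> R.

Definition length_function L : Prop :=
  [/\ forall g, 0 <= L g,
      L 1%g = 0,
      forall g, L g^-1%g = L g &
      forall g h, L (g * h)%g <= L g + L h].

Definition length_kernel L : set G := [set g | L g = 0].

End LengthFunctions.

Section RapidDecay.
Variables (R : realType) (G : groupType).
Implicit Types (H : {pred G}) (L : G -> R) (f xi : G -> R[i]) (s : R).

Definition left_invariant H xi : Prop :=
  forall h g, h \in H -> xi (h * g)%g = xi g.

Definition biinvariant H f : Prop :=
  forall h g k, h \in H -> k \in H -> f (h * g * k)%g = f g.

(* Functions on G // H (resp. H \ G) are represented by the H-bi-invariant
   (resp. left H-invariant) functions on G. *)
Definition hecke_algebra H : set (G -> R[i]) :=
  [set f | biinvariant H f /\
           finite_set [set dcoset H g | g in [set g | f g != 0]]].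

Definition l2_norm H xi : \bar R :=
  sqrte (\esum_(c in rcosets H) (Normc.normc (xi (coset_repr c)) ^+ 2)%:E)%E.

Definition l2 H : set (G -> R[i]) :=
  [set xi | left_invariant H xi /\ (l2_norm H xi < +oo)%E].

(* For f in the Hecke algebra of a Hecke pair and xi left H-invariant, the
   summand is independent of the representatives and, for each g, vanishes for
   all but finitely many cosets, so the finitely supported sum below is the
   genuine one (it would be 0 by convention on an infinite support). *)
Definition regular_repr H f xi : G -> R[i] := fun g =>
  \sum_(c \in rcosets H) (f (g * (coset_repr c)^-1)%g * xi (coset_repr c)).

(* The operator norm on l2 H, equal to +oo if T is unbounded *)
Definition op_norm H (T : (G -> R[i]) -> (G -> R[i])) : \bar R :=
  ereal_sup [set l2_norm H (T xi) | xi in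
               [set xi | l2 H xi /\ (l2_norm H xi <= 1)%E]].

Definition sobolev_norm H L s f : \bar R :=
  sqrte (\esum_(c in rcosets H)
    (Normc.normc (f (coset_repr c)) ^+ 2
       * (1 + L (coset_repr c)) `^ (2 * s))%:E)%E.

Definition property_RD H L : Prop :=
  exists C s : R, [/\ 0 < C, 0 < s &
    forall f, hecke_algebra H f ->
      (op_norm H (regular_repr H f) <= C%:E * sobolev_norm H L s f)%E].

End RapidDecay.

(* Main.v *)
(* By symmetry, suppose that (G, H) has (RD). Given f in the Hecke algebra of
   (G, K) and xi in l^2(K \ G), replace |f| by the H-bi-invariant function F(g)
   = max |f|(a g b^-1) and |xi| by the left H-invariant function X(g)
   = max |xi|(a g), where a and b run over finitely many elements of H
   representing H modulo H :&: K. Both maxima dominate the original functions,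
   while their squares are at most the sums of the squares of the translates;
   hence the norms of F and X relative to H are bounded by those of f and xi
   relative to K, up to constants depending only on the indices of H :&: K
   (L is unchanged by the translations by elements of H). Likewise
   |f * xi| <= C (F * X) pointwise, so the (RD) estimate for F yields the one
   for f. *)

Require Import Defs.
From mathcomp Require Import all_boot all_order all_algebra.
From mathcomp Require Import all_classical all_reals all_analysis.
From mathcomp Require Import complex lra.

Set Implicit Arguments.
Unset Strict Implicit.
Unset Printing Implicit Defensive.

Import Order.TTheory GRing.Theory Num.Theory.

Local Open Scope classical_set_scope.
Local Open Scope ring_scope.
Local Open Scope complex_scope.

(** * Comparison of sums of non-negative extended reals *)

Lemma le_esum_inj (R : realType) (T T' : choiceType) (P : set T) (Q : set T')
    (p : T -> T') (f : T -> \bar R) (g : T' -> \bar R) :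
  (forall x, P x -> Q (p x)) -> set_inj P p ->
  (forall x, P x -> (f x <= g (p x))%E) -> (forall y, Q y -> (0 <= g y)%E) ->
  (\esum_(x in P) f x <= \esum_(y in Q) g y)%E.
Proof.
move=> PQ pinj fg g0; apply: (le_trans (le_esum fg)).
rewrite -(esum_image _ _ g pinj) -[in leLHS](_ : Q `&` p @` P = p @` P).
  by rewrite (esumID (p @` P) Q) // leeDl // esum_ge0 // => y [/g0].
by apply/setIidPr => _ [x /PQ Qx <-].
Qed.

(* q need not be injective: x in P is recovered from (a, y) as q a y. *)
Lemma le_esum_cover (R : realType) (T T' : choiceType) (I : eqType)
    (A : seq I) (q : I -> T' -> T) (P : set T) (Q : set T')
    (f : T -> \bar R) (g : T' -> \bar R) :
  (forall x, P x -> exists a y,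
    [/\ a \in A, Q y, x = q a y & (f x <= g y)%E]) ->
  (forall x, P x -> (0 <= f x)%E) -> (forall y, Q y -> (0 <= g y)%E) ->
  (\esum_(x in P) f x <= (size A)%:R%:E * \esum_(y in Q) g y)%E.
Proof.
move=> + + g0; elim: A P => [|a A IH] P PA f0.
  rewrite esum1 ?mul0e // => x /PA [? [? []]] //.
(* Induction on [A]: [Pa] collects the points reached through the head [a], and the tail of [A]
   covers the rest of [P]. *)
pose Pa := [set x | exists y, [/\ Q y, x = q a y & (f x <= g y)%E]].
rewrite (esumID Pa) //= -natr1 EFinD ge0_muleDl ?lee_fin // addeC mul1e.
apply: leeD; last first.
  (* [choice] produces a total function, so a default [y0] is needed off the set; this is why the
     empty case is treated apart. *)
  have [->|/set0P[_ [_ [y0 _]]]] := eqVneq (P `&` Pa) set0.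
    by rewrite esum_set0 esum_ge0.
  have /choice [p pP] : forall x, exists y, (P `&` Pa) x ->
      [/\ Q y, x = q a y & (f x <= g y)%E].
    by move=> x; have [[_ [y ?]]|?] := pselect ((P `&` Pa) x); [exists y|exists y0].
  apply: (@le_esum_inj _ _ _ _ _ p) => // [x /pP[]//|x x'|x /pP[]//].
  by move=> /set_mem/pP[_ xE _] /set_mem/pP[_ x'E _] pxx'; rewrite xE x'E pxx'.
apply: IH => [x [Px nPax]|x [/f0//]].
have [b [y [+ Qy xE fg]]] := PA _ Px.
rewrite inE => /orP[/eqP ba|bA]; last by exists b, y.
by case: nPax; exists y; rewrite -ba.
Qed.

(** * Cosets, and covers of one subgroup by cosets of the intersection *)

Section Cosets.
Variable G : groupType.
Implicit Types (A : seq G) (g x y : G) (c : set G).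

Lemma rcosetMl (H : groupClosed G) h g : h \in H -> rcoset H (h * g)%g = rcoset H g.
Proof.
move=> hH; apply/seteqP; split => _ [k /= kH <-].
  by exists (k * h)%g; rewrite /= ?gpredM // mulgA.
by exists (k / h)%g; rewrite /= ?gpredF // -mulgA mulKg.
Qed.

Lemma coset_repr_rcoset (H : groupClosed G) g :
  exists2 h, h \in H & coset_repr (rcoset H g) = (h * g)%g.
Proof.
rewrite /coset_repr; have [|h hH <-] := @xgetPex _ 1%g (rcoset H g); last by exists h.
by exists (1 * g)%g; exists 1%g => //=; exact: gpred1.
Qed.

Lemma rcoset_repr (H : groupClosed G) c : rcosets H c -> c = rcoset H (coset_repr c).
Proof. by case=> g _ <-; have [h hH ->] := coset_repr_rcoset H g; rewrite rcosetMl. Qed.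

Lemma dcosetM (H : groupClosed G) h g k : h \in H -> k \in H ->
  dcoset H (h * g * k)%g = dcoset H g.
Proof.
move=> hH kH; apply/seteqP; split => _ [a /= aH [b /= bH <-]].
  by exists (a * h)%g; rewrite /= ?gpredM //; exists (k * b)%g;
    rewrite /= ?gpredM // !mulgA.
exists (a / h)%g; rewrite /= ?gpredF //; exists (k^-1 * b)%g.
  by rewrite /= gpredM // gpredV.
by rewrite !mulgA mulgVK mulgK.
Qed.

(* K is the union of the right cosets (H :&: K) a with a in A. *)
Definition coset_cover (H K : {pred G}) A :=
  {subset A <= K} /\ forall k, k \in K -> exists2 a, a \in A & (k / a)%g \in H.

(** Inversion turns the left cosets [b M] counted by [finite_index] into the right cosets [M b^-1]
    required of a cover, so [A] consists of the inverses of representatives of the left cosets. *)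
Lemma finite_index_cover (H K : groupClosed G) :
  finite_index [predI H & K] K -> exists A, coset_cover H K A.
Proof.
set M := [predI H & K] => /finite_seqP[C CE].
have M1 : 1%g \in M by rewrite !inE !gpred1.
exists [seq (coset_repr c)^-1%g | c <- C].
have reprP b : b \in K ->
    exists2 m, m \in M & coset_repr (lcoset M b) = (b * m)%g.
  move=> _; rewrite /coset_repr.
  have [|m mM <-] := @xgetPex _ 1%g (lcoset M b); last by exists m.
  by exists (b * 1)%g; exists 1%g.
split=> [_ /mapP[c cC ->]|k kK].
  have : [set` C] c by [].
  rewrite -CE => -[b bK <-]; have [m + ->] := reprP _ bK.
  by rewrite !inE gpredV => /andP[_ mK]; rewrite gpredM.
have k'K : k^-1%g \in K by rewrite gpredV.
exists (coset_repr (lcoset M k^-1%g))^-1%g.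
  apply/mapP; exists (lcoset M k^-1%g) => //.
  have : [set lcoset M b | b in [set` K]] (lcoset M k^-1%g) by exists k^-1%g.
  by rewrite CE.
have [m + ->] := reprP _ k'K.
by rewrite !inE invgK mulVKg => /andP[].
Qed.

(** * Sums over right cosets *)

Variable R : realType.

(** The squares of [l2_norm] and [sobolev_norm] have this form. The value depends on the chosen
    representatives unless [phi] is left [H]-invariant; the cover comparison below asks invariance
    of the larger function only. *)
Definition sum_rcosets (H : {pred G}) (phi : G -> \bar R) : \bar R :=
  \esum_(c in rcosets H) phi (coset_repr c).

(* The coset H x is one of the H e y b^-1, where y represents K a x b and e
   runs over the cover A. *)
Lemma le_sum_rcosets_cover (H K : groupClosed G) A (phi psi : G -> \bar R) a b :
  coset_cover H K A -> (forall x, 0 <= psi x)%E -> (forall x, 0 <= phi x)%E ->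
  (forall x, psi x <= phi (a * x * b)%g)%E ->
  (forall k x, k \in K -> phi (k * x)%g = phi x) -> a \in H ->
  (sum_rcosets H psi <= (size A)%:R%:E * sum_rcosets K phi)%E.
Proof.
move=> [AK Acov] psi0 phi0 psiphi phiK aH.
apply: (le_esum_cover (q := fun e d => rcoset H (e * coset_repr d * b^-1)%g)).
- move=> c /rcoset_repr cE; set x := coset_repr c in cE *.
  have [k kK yE] := coset_repr_rcoset K (a * x * b)%g.
  have k'K : k^-1%g \in K by rewrite gpredV.
  have [e eA kH] := Acov _ k'K.
  exists e, (rcoset K (a * x * b)%g); split=> //; first by exists (a * x * b)%g.
    rewrite yE cE.
    have -> : (e * (k * (a * x * b)) / b = (e * k * a) * x)%g by rewrite !mulgA mulgK.
    rewrite rcosetMl // gpredM //.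
    by rewrite -gpredV invgM.
  by rewrite yE phiK.
- by move=> c _.
- by move=> d _.
Qed.

(** * Maxima over a cover *)

Definition cover_max A (u : G -> R) : R := \big[Num.max/0]_(a <- A) u a.

Lemma cover_max_ge0 A u : 0 <= cover_max A u.
Proof. exact: bigmax_ge_id. Qed.

(** If [h] lies in [K a] with [a] in [A], then [u h = u a]; so the maximum over the finite list [A]
    controls [u] on the whole of [H]. *)
Lemma le_cover_max (H K : groupClosed G) A u h : coset_cover K H A ->
  (forall k x, k \in K -> u (k * x)%g = u x) -> h \in H -> u h <= cover_max A u.
Proof.
move=> [_ Acov] uK hH; have [a aA haK] := Acov _ hH.
by rewrite -(mulgVK a h) uK //; exact: (le_bigmax_seq 0 a xpredT u aA).
Qed.

(** Both sides are the maximum of 0 and the values of [u] on all of [H], a set which right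
    translation by [h] permutes. The reverse inequality is [le_cover_max] for the translate [u'] at
    [a / h]. *)
Lemma cover_max_translate (H K : groupClosed G) A u h : coset_cover K H A ->
  (forall k x, k \in K -> u (k * x)%g = u x) -> h \in H ->
  cover_max A (fun a => u (a * h)%g) = cover_max A u.
Proof.
move=> Acov uK hH; have AH := Acov.1.
apply/eqP; rewrite eq_le; apply/andP; split.
  rewrite [leLHS]/cover_max big_seq bigmax_le ?cover_max_ge0 // => a aA.
  by apply: (le_cover_max Acov) => //; rewrite gpredM // AH.
rewrite [leLHS]/cover_max big_seq bigmax_le ?cover_max_ge0 // => a aA.
set u' := fun a => u (a * h)%g.
have u'K k x : k \in K -> u' (k * x)%g = u' x by move=> kK; rewrite /u' -mulgA (uK k).
have ahH : (a / h)%g \in H by rewrite gpredF // AH.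
by have := le_cover_max Acov u'K ahH; rewrite {1}/u' mulgVK.
Qed.

(** This trades the maximum, chosen for its invariance, for a sum of translates whose norms can be
    estimated one at a time. *)
Lemma cover_max_sqr A u : (forall a, 0 <= u a) -> cover_max A u ^+ 2 <= \sum_(a <- A) u a ^+ 2.
Proof.
move=> u0; rewrite /cover_max; elim: A => [|a A IH]; first by rewrite !big_nil expr0n.
rewrite !big_cons; case: (leP (u a) (\big[_/_]_(_ <- A) _)) => _.
  by apply: (le_trans IH); rewrite lerDr sqr_ge0.
by rewrite lerDl sumr_ge0 // => b _; rewrite sqr_ge0.
Qed.

(** * Operations on coset sums, and supports of Hecke algebra elements *)

Lemma le_sum_rcosets (H : {pred G}) (phi psi : G -> \bar R) :
  (forall x, phi x <= psi x)%E -> (sum_rcosets H phi <= sum_rcosets H psi)%E.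
Proof. by move=> le_phi; exact: le_esum. Qed.

Lemma sum_rcosets_sum (H : {pred G}) A (phi : G -> G -> \bar R) :
  (forall a x, 0 <= phi a x)%E ->
  sum_rcosets H (fun x => \sum_(a <- A) phi a x)%E = (\sum_(a <- A) sum_rcosets H (phi a))%E.
Proof. by move=> phi0; rewrite /sum_rcosets esum_sum. Qed.

Lemma sum_rcosetsZ (H : {pred G}) r (phi : G -> \bar R) : 0 <= r ->
  (forall x, 0 <= phi x)%E ->
  (sum_rcosets H (fun x => r%:E * phi x)%E <= r%:E * sum_rcosets H phi)%E.
Proof.
move=> r0 phi0; apply: ge_ereal_sup => _ [D [Dfin DH] <-].
rewrite fsbig_finite //= -ge0_sume_distrr //.
rewrite lee_wpmul2l ?lee_fin // -fsbig_finite //.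
by apply: ereal_sup_ubound; exists D.
Qed.

(** Each of the finitely many double cosets in the support is a finite union of left cosets [x H] by
    almost normality; [S] gathers these [x]. *)
Lemma hecke_algebra_support (H : groupClosed G) (f : G -> R[i]) :
  almost_normal H -> hecke_algebra H f ->
  exists S : seq G, forall g, f g != 0 -> exists2 x, x \in S & (x^-1 * g)%g \in H.
Proof.
move=> Han [_ /finite_seqP[D DE]].
have : forall d, d \in D -> exists S : seq G, forall g, d g ->
    exists2 x, x \in S & (x^-1 * g)%g \in H.
  move=> d dD; have : [set` D] d by [].
  rewrite -DE => -[g0 _ <-]; have [_ /finite_seqP[S ->] SE] := Han g0.
  exists S => g; rewrite SE => -[x xS [h /= hH <-]]; exists x => //.
  by rewrite mulKg.
have : forall g, f g != 0 -> exists2 d, d \in D & d g.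
  move=> g fg; exists (dcoset H g).
    have : [set dcoset H g | g in [set g | f g != 0]] (dcoset H g) by exists g.
    by rewrite DE.
  by exists 1%g; rewrite /= ?gpred1//; exists 1%g; rewrite /= ?gpred1// mul1g mulg1.
move: {DE} D => D fD DS.
have [S SP] : exists S : seq G, forall d g, d \in D -> d g ->
    exists2 x, x \in S & (x^-1 * g)%g \in H.
  elim: D {fD} DS => [|d D IH] DS; first by exists [::].
  have [S SP] := IH (fun d' d'D => DS d' (@mem_behead _ (d :: D) _ d'D)).
  have [S' S'P] := DS d (mem_head _ _).
  exists (S' ++ S) => d' g; rewrite inE => /orP[/eqP-> /S'P|d'D /(SP _ _ d'D)] [x xS ?];
    by exists x; rewrite // mem_cat xS ?orbT.
by exists S => g /fD[d dD dg]; exact: SP dD dg.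
Qed.

(** * Moduli and pointwise bounds for the convolution *)

Local Notation normc := (@Normc.normc R).

Lemma normc_ge0 (z : R[i]) : 0 <= normc z.
Proof. by rewrite /Normc.normc; case: z => a b; exact: sqrtr_ge0. Qed.

Lemma normc_real (r : R) : normc r%:C = `|r|.
Proof. by rewrite /= expr0n addr0 sqrtr_sqr. Qed.

Lemma le_normc_sum (I : Type) (r : seq I) (z : I -> R[i]) :
  normc (\sum_(i <- r) z i) <= \sum_(i <- r) normc (z i).
Proof.
elim/big_rec2: _ => [|i y z' _ le_zy]; first by rewrite Normc.normc0.
by apply: (le_trans (le_normcD _ _)); rewrite lerD2l.
Qed.

Lemma normc_regular_repr_le (H : {pred G}) (f xi : G -> R[i]) g :
  ((normc (regular_repr H f xi g))%:E <=
     sum_rcosets H (fun x => (normc (f (g / x)%g) * normc (xi x))%:E))%E.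
Proof.
rewrite /regular_repr; set F := fun c => (_ * _)%R.
pose D := rcosets H `&` F @^-1` [set~ 0].
(* On an infinite support the sum is 0 by convention and the bound is trivial; otherwise it is the
   triangle inequality. *)
have [Dfin|Dinf] := pselect (finite_set D); last first.
  rewrite fsbig_dflt // Normc.normc0.
  by apply: esum_ge0 => c _; rewrite lee_fin mulr_ge0 ?normc_ge0.
rewrite fsbig_supp -/D.
apply: esum_ge; exists D; first by split => // c [].
rewrite !fsbig_finite //= sumEFin lee_fin (le_trans (le_normc_sum _ _)) //.
by apply: ler_sum => c _; rewrite Normc.normcM.
Qed.

(** If [f (g / x)] is non-zero, then [x] lies in [H y^-1 g] for some [y] in [S]. Hence only the
    finitely many cosets in [D] contribute, and the convolution is the genuine sum of non-negative
    terms. *)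
Lemma normc_regular_repr_ge (H : groupClosed G) (f xi : G -> R) g (S : seq G) :
  (forall x, 0 <= f x) -> (forall x, 0 <= xi x) ->
  (forall x, f x != 0 -> exists2 y, y \in S & (y^-1 * x)%g \in H) ->
  (sum_rcosets H (fun x => (f (g / x)%g * xi x)%:E) <=
   (normc (regular_repr H (fun x => (f x)%:C) (fun x => (xi x)%:C) g))%:E)%E.
Proof.
move=> f0 xi0 fS.
pose D := [set rcoset H (y^-1 * g)%g | y in [set` S]].
have Dfin : finite_set D by apply: finite_image; exact: finite_seq.
have DH : D `<=` rcosets H by move=> _ [y _ <-]; exists (y^-1 * g)%g.
have D0 c : rcosets H c -> ~ D c -> f (g / coset_repr c)%g = 0.
  move=> Hc nDc; apply/eqP; apply: contra_notT nDc => /fS[y yS yH].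
  exists y => //; rewrite (rcoset_repr Hc) -[in RHS](rcosetMl _ yH).
  by rewrite -!mulgA mulVg mulg1.
rewrite /regular_repr -(fsbig_widen D) //; last first.
  by move=> c [Hc nDc] /=; rewrite D0 // mul0r.
rewrite /sum_rcosets (esumID D) => [|c _]; last by rewrite lee_fin mulr_ge0.
rewrite (setIidr DH) [X in (_ + X)%E]esum1 => [|c [Hc nDc]]; last by rewrite D0 ?mul0r.
rewrite adde0 esum_fset => // [|c _]; last by rewrite lee_fin mulr_ge0.
rewrite !fsbig_finite //= sumEFin lee_fin.
under [X in normc X]eq_bigr do rewrite -rmorphM.
by rewrite -rmorph_sum normc_real ler_norm.
Qed.

Lemma cover_max_neq0 A (u : G -> R) :
  cover_max A u != 0 -> exists2 a, a \in A & u a != 0.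
Proof.
move=> nz; apply: contrapT => none; case/eqP: nz.
rewrite /cover_max big_seq; elim/big_ind: _ => // [_ _ -> ->|a aA].
  exact: maxxx.
by apply/eqP; apply: contra_notT none => ua; exists a.
Qed.

(** Each [a] in [A] is one application of the cover comparison, at the cost of a factor [size B]. *)
Lemma sum_rcosets_translates (H K : groupClosed G) A B (phi : G -> \bar R) b :
  {subset A <= H} -> coset_cover H K B -> (forall x, 0 <= phi x)%E ->
  (forall k x, k \in K -> phi (k * x)%g = phi x) ->
  (sum_rcosets H (fun x => \sum_(a <- A) phi (a * x * b)%g)%E <=
     (size A * size B)%:R%:E * sum_rcosets K phi)%E.
Proof.
move=> AH Bcov phi0 phiK; rewrite sum_rcosets_sum //.
have S0 : (0 <= sum_rcosets K phi)%E by apply: esum_ge0.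
elim: A AH => [|a A IH] AH; first by rewrite big_nil mul0n mul0e.
rewrite big_cons /= mulSn natrD EFinD ge0_muleDl ?lee_fin //.
apply: leeD; last by apply: IH => x xA; rewrite AH // inE xA orbT.
by apply: (le_sum_rcosets_cover Bcov) => //; rewrite AH ?mem_head.
Qed.

(* For A representing H modulo H :&: K and u bi-K-invariant, this is the
   maximum of u over the double coset H g H. *)
Definition cover_bimax A (u : G -> R) g : R :=
  cover_max A (fun a => cover_max A (fun b => u (a * g / b)%g)).

(** * Passing from functions for [K] to functions for [H] *)

Section Transfer.
Variables (H K : groupClosed G) (A B : seq G).
Hypotheses (Acov : coset_cover K H A) (Bcov : coset_cover H K B).

Section Bimax.
Variable u : G -> R.
Hypotheses (u_ge0 : forall x, 0 <= u x)
  (uKl : forall k x, k \in K -> u (k * x)%g = u x)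
  (uKr : forall k x, k \in K -> u (x * k)%g = u x).

Let divKr g k x : k \in K -> u (g / (k * x))%g = u (g / x)%g.
Proof. by move=> kK; rewrite -gpredV in kK; rewrite invgM mulgA (uKr _ kK). Qed.

Let divKl g k x b : k \in K -> u (k * x * g / b)%g = u (x * g / b)%g.
Proof. by move=> kK; rewrite -!mulgA (uKl _ kK). Qed.

(** The factor [k] translates the inner variable [b] by [k^-1], and [h] translates the outer
    variable [a]; [cover_max_translate] absorbs each in turn. *)
Lemma cover_bimax_biinvariant h g k : h \in H -> k \in H ->
  cover_bimax A u (h * g * k)%g = cover_bimax A u g.
Proof.
move=> hH kH; rewrite /cover_bimax.
pose v x := cover_max A (fun b => u (x * g / b)%g).
transitivity (cover_max A (fun a => v (a * h)%g)).
  apply: eq_bigr => a _; rewrite /v.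
  have := cover_max_translate Acov (u := fun x => u (a * h * g / x)%g) _ (h := k^-1%g).
  move=> <- //; last 2 first.
  - by move=> k' x; exact: divKr.
  - by rewrite gpredV.
  by apply: eq_bigr => b _; rewrite invgM invgK !mulgA.
apply: (cover_max_translate Acov) => // k' x kK.
by apply: eq_bigr => b _; rewrite divKl.
Qed.

(** The value [u g] occurs at [a = b = 1]; 1 need not belong to [A], but it belongs to [H], which
    suffices for [le_cover_max]. *)
Lemma le_cover_bimax g : u g <= cover_bimax A u g.
Proof.
rewrite /cover_bimax.
have H1 : 1%g \in H by exact: gpred1.
apply: (@le_trans _ _ (cover_max A (fun b => u (1 * g / b)%g))).
  have := @le_cover_max _ _ _ (fun b => u (1 * g / b)%g) _ Acov _ H1.
  rewrite invg1 mulg1 mul1g; apply => k x; exact: divKr.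
apply: (@le_cover_max _ _ _ (fun a => cover_max A (fun b => u (a * g / b)%g)) _ Acov _ H1).
by move=> k x kK; apply: eq_bigr => b _; rewrite divKl.
Qed.

Lemma cover_bimax_sqr g :
  cover_bimax A u g ^+ 2 <= \sum_(b <- A) \sum_(a <- A) u (a * g / b)%g ^+ 2.
Proof.
rewrite exchange_big /=.
apply: (le_trans (cover_max_sqr _ _)) => [a|]; first exact: cover_max_ge0.
by apply: ler_sum => a _; exact: cover_max_sqr.
Qed.

Lemma cover_bimax_neq0 g : cover_bimax A u g != 0 ->
  exists a b, [/\ a \in A, b \in A & u (a * g / b)%g != 0].
Proof. by move=> /cover_max_neq0[a aA /cover_max_neq0[b bA nz]]; exists a, b. Qed.

End Bimax.

(** Where the maximum is non-zero, some [a g b^-1] lies in [x K] with [x] in the finite list [S]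
    supporting [f]. The cover [B] of [K] puts it in [x e^-1 H] with [e] in [B], so
    [H g H = H x e^-1 H] and only finitely many pairs [(x, e)] arise. *)
Lemma cover_bimax_hecke (f : G -> R[i]) : almost_normal K -> hecke_algebra K f ->
  hecke_algebra H (fun g => (cover_bimax A (fun x => normc (f x)) g)%:C).
Proof.
move=> Kan fK; have [fKK _] := fK; set u := fun x => normc (f x).
have uKl k x : k \in K -> u (k * x)%g = u x.
  by move=> kK; rewrite /u -[(k * x)%g]mulg1 fKK ?gpred1.
have uKr k x : k \in K -> u (x * k)%g = u x.
  by move=> kK; rewrite /u -[x in LHS]mul1g fKK ?gpred1.
split=> [h g k hH kH|]; first by rewrite cover_bimax_biinvariant.
have [S fS] := hecke_algebra_support Kan fK.
apply: (@sub_finite_set _ _ [set dcoset H (p.1 / p.2)%g | p in [set` S] `*` [set` B]]); last first.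
  by apply/finite_image/finite_setX; exact: finite_seq.
move=> _ [g + <-]; rewrite /= fmorph_eq0 => /cover_bimax_neq0[a [b [aA bA nz]]].
have /fS[x xS xK] : f (a * g / b)%g != 0.
  by apply: contraNneq nz => f0; rewrite /u f0 Normc.normc0.
have xK' := xK; rewrite -gpredV in xK'; have [e eB] := Bcov.2 _ xK'.
rewrite -gpredV invgM !invgK => eH.
exists (x, e) => //=.
have [AH _] := Acov.
have b'H : b^-1%g \in H by rewrite gpredV AH.
rewrite -(dcosetM g (AH _ aA) b'H) -(dcosetM _ gpred1 eH).
by congr dcoset; rewrite mul1g !mulgA mulgVK mulgV mul1g.
Qed.

(** * Convolutions and norms for the two subgroups *)

Lemma regular_repr_left_invariant (f xi : G -> R[i]) k g : biinvariant K f ->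
  k \in K -> regular_repr K f xi (k * g)%g = regular_repr K f xi g.
Proof.
move=> fK kK; apply: eq_fsbigr => c _.
congr (_ * _); have := fK k (g / coset_repr c)%g 1%g kK gpred1.
by rewrite mulg1 mulgA.
Qed.

(** The function [F (g / x) * X x] of [x] is left [H]-invariant, so its sum over [K]-cosets is at
    most [size A] times its sum over [H]-cosets. The finite support of [F] makes the latter an
    actual convolution. *)
Lemma le_regular_repr (f xi : G -> R[i]) (F X : G -> R) (t : R) g (S : seq G) :
  (forall x, 0 <= F x) -> (forall x, 0 <= X x) -> 0 <= t ->
  (forall x, normc (f x) <= F x) -> (forall x, normc (xi x) <= t * X x) ->
  (forall h x k, h \in H -> k \in H -> F (h * x * k)%g = F x) ->
  (forall h x, h \in H -> X (h * x)%g = X x) ->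
  (forall x, F x != 0 -> exists2 y, y \in S & (y^-1 * x)%g \in H) ->
  normc (regular_repr K f xi g) <= (size A)%:R * t *
    normc (regular_repr H (fun x => (F x)%:C) (fun x => (X x)%:C) g).
Proof.
move=> F0 X0 t0 fF xiX FH XH FS; rewrite -lee_fin.
apply: (le_trans (normc_regular_repr_le _ _ _ _)).
pose phi x : \bar R := (t%:E * (F (g / x)%g * X x)%:E)%E.
have FX0 x : (0 <= (F (g / x)%g * X x)%:E)%E by rewrite lee_fin mulr_ge0.
have FXH h x : h \in H -> F (g / (h * x))%g * X (h * x)%g = F (g / x)%g * X x.
  move=> hH; rewrite -gpredV in hH.
  have := FH 1%g (g / x)%g _ gpred1 hH; rewrite mul1g -mulgA -invgM => ->.
  by rewrite XH // -gpredV.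
have phi0 x : (0 <= phi x)%E by rewrite mule_ge0 // lee_fin.
apply: (@le_trans _ _ ((size A)%:R%:E * sum_rcosets H phi)%E).
  apply: (le_sum_rcosets_cover (a := 1%g) (b := 1%g) Acov) => //.
  - by move=> x; rewrite lee_fin mulr_ge0 ?normc_ge0.
  - move=> x; rewrite mul1g mulg1 /phi -EFinM lee_fin mulrCA.
    by rewrite ler_pM ?normc_ge0.
  - by move=> h x hH; rewrite /phi FXH.
  - exact: gpred1.
rewrite -mulrA EFinM lee_wpmul2l ?lee_fin //.
apply: (le_trans (sum_rcosetsZ _ t0 FX0)).
rewrite EFinM lee_wpmul2l ?lee_fin //.
exact: normc_regular_repr_ge FS.
Qed.

(** For the squared norms, the pointwise bound costs [c ^+ 2] and the change from [H]-cosets to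
    [K]-cosets costs [size A]. *)
Lemma l2_norm_le (xi eta : G -> R[i]) (c : R) : 0 <= c ->
  (forall x, normc (xi x) <= c * normc (eta x)) ->
  (forall h x, h \in H -> eta (h * x)%g = eta x) ->
  (l2_norm K xi <= (Num.sqrt ((size A)%:R * c ^+ 2))%:E * l2_norm H eta)%E.
Proof.
move=> c0 xieta etaH.
have sq0 (z : R[i]) : (0 <= (normc z ^+ 2)%:E)%E by rewrite lee_fin sqr_ge0.
have S0 : (0 <= sum_rcosets H (fun x => (normc (eta x) ^+ 2)%:E))%E by apply: esum_ge0.
have Ac0 : 0 <= (size A)%:R * c ^+ 2 by rewrite mulr_ge0 ?sqr_ge0.
rewrite -[X in (X * _)%E]/(sqrte ((size A)%:R * c ^+ 2)%:E) -sqrteM ?lee_fin //.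
rewrite lee_sqrt ?mule_ge0 ?lee_fin //.
pose phi x : \bar R := ((c ^+ 2)%:E * (normc (eta x) ^+ 2)%:E)%E.
have phi0 x : (0 <= phi x)%E by rewrite mule_ge0 ?lee_fin ?sqr_ge0.
apply: (@le_trans _ _ ((size A)%:R%:E * sum_rcosets H phi)%E).
  rewrite -[leLHS]/(sum_rcosets K (fun x => (normc (xi x) ^+ 2)%:E)).
  apply: (le_sum_rcosets_cover (a := 1%g) (b := 1%g) Acov) => //.
  - move=> x; rewrite mul1g mulg1 /phi -EFinM lee_fin -exprMn.
    by rewrite lerXn2r ?nnegrE ?mulr_ge0 ?normc_ge0.
  - by move=> h x hH; rewrite /phi etaH.
  - exact: gpred1.
rewrite EFinM -muleA lee_wpmul2l ?lee_fin //.
by apply: sum_rcosetsZ; rewrite ?sqr_ge0.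
Qed.

Lemma sum_rcosets_cover_max_sqr (u : G -> R) :
  (forall x, 0 <= u x) -> (forall k x, k \in K -> u (k * x)%g = u x) ->
  (sum_rcosets H (fun x => (cover_max A (fun a => u (a * x)%g) ^+ 2)%:E) <=
   (size A * size B)%:R%:E * sum_rcosets K (fun x => (u x ^+ 2)%:E))%E.
Proof.
move=> u0 uK.
pose phi x : \bar R := (u x ^+ 2)%:E.
apply: le_trans (@sum_rcosets_translates H K A B phi 1%g _ _ _ _); last 4 first.
- exact: Acov.1.
- exact: Bcov.
- by move=> x; rewrite lee_fin sqr_ge0.
- by move=> k x kK; rewrite /phi uK.
apply: le_sum_rcosets => x; rewrite /phi sumEFin lee_fin.
under eq_bigr do rewrite mulg1.
exact: cover_max_sqr.
Qed.

(** Since [L] vanishes on [H], subadditivity in both directions shows that the weight is unchanged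
    by translation by [A] on either side. The [size A] right translates each cost [size A * size B]
    from the left ones. *)
Lemma sobolev_norm_cover_bimax (L : G -> R) (f : G -> R[i]) s :
  length_function L -> [set` H] `<=` length_kernel L -> [set` K] `<=` length_kernel L ->
  biinvariant K f ->
  (sobolev_norm H L s (fun g => (cover_bimax A (fun x => normc (f x)) g)%:C) <=
   (Num.sqrt (size A * (size A * size B))%:R)%:E * sobolev_norm K L s f)%E.
Proof.
move=> [L0 L1 LV LM] LH LK fK; set u := fun x => normc (f x).
have LHl h x : L h = 0 -> L (h * x)%g = L x.
  move=> Lh; apply/eqP; rewrite eq_le; apply/andP; split.
    by rewrite (le_trans (LM _ _)) // Lh add0r.
  by rewrite -[x in leLHS](mulKg h) (le_trans (LM _ _)) // LV Lh add0r.
have LHr h x : L h = 0 -> L (x * h)%g = L x.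
  by move=> Lh; rewrite -LV invgM LHl ?LV.
have uKl k x : k \in K -> u (k * x)%g = u x.
  by move=> kK; rewrite /u -[(k * x)%g]mulg1 fK ?gpred1.
have u0 x : 0 <= u x by exact: normc_ge0.
pose w x := (1 + L x) `^ (2 * s).
have w0 x : 0 <= w x by exact: powR_ge0.
pose phi x : \bar R := (u x ^+ 2 * w x)%:E.
have phi0 x : (0 <= phi x)%E by rewrite lee_fin mulr_ge0 ?sqr_ge0.
have S0 : (0 <= sum_rcosets K phi)%E by apply: esum_ge0.
rewrite -[X in (X * _)%E]/(sqrte _%:E) -sqrteM ?lee_fin //.
rewrite lee_sqrt ?mule_ge0 ?lee_fin //.
rewrite -[leLHS]/(sum_rcosets H (fun x => (normc (cover_bimax A u x)%:C ^+ 2 * w x)%:E)).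
have AH := Acov.1.
apply: (@le_trans _ _ (\sum_(b <- A)
    sum_rcosets H (fun x => \sum_(a <- A) phi (a * x * b^-1)%g)%E)%E).
  rewrite -sum_rcosets_sum; last by move=> a x; apply: sume_ge0.
  apply: le_sum_rcosets => x; under eq_bigr do rewrite sumEFin.
  rewrite sumEFin lee_fin normc_real ger0_norm ?cover_max_ge0 //.
  apply: (le_trans (ler_wpM2r (w0 x) (cover_bimax_sqr u0 x))).
  rewrite mulr_suml big_seq [leRHS]big_seq ler_sum // => b bA.
  rewrite mulr_suml big_seq [leRHS]big_seq ler_sum // => a aA.
  rewrite /w [L (_ / _)%g]LHr ?LHl //; first exact/LH/AH.
  by rewrite LV; exact/LH/AH.
rewrite natrM EFinM -muleA.
apply: (@le_trans _ _ (\sum_(b <- A) ((size A * size B)%:R%:E * sum_rcosets K phi))%E).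
  apply: lee_sum => b _; apply: sum_rcosets_translates => //.
  by move=> k x kK; rewrite /phi uKl // /w LHl //; exact: LK.
have -> : (size A)%:R%:E = (\sum_(b <- A) 1%:E)%E :> \bar R.
  by rewrite sumEFin big_const_seq count_predT iter_addr_0.
by rewrite ge0_sume_distrl //; under [leRHS]eq_bigr do rewrite mul1e.
Qed.

End Transfer.

(** * Transfer of (RD) *)

Lemma property_RD_transfer (H K : groupClosed G) (L : G -> R) :
  strongly_commensurable H K -> almost_normal H -> almost_normal K ->
  length_function L ->
  [set` H] `<=` length_kernel L -> [set` K] `<=` length_kernel L ->
  property_RD H L -> property_RD K L.
Proof.
move=> [finH finK] Han Kan Llen LH LK [C [s [C0 s0 RD]]].
have [A Acov] : exists A, coset_cover K H A.
  apply: finite_index_cover; rewrite (_ : [predI K & H] = [predI H & K] :> {pred G}) //.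
  by apply/funext => x; rewrite /= andbC.
have [B Bcov] := finite_index_cover finK.
(* [n] bounds the factor by which passing to the maximum of translates enlarges the squared norm of
   [xi]; dividing by [t] compensates, as [n <= t ^+ 2], and [t] is positive even if [n = 0]. *)
pose n : R := (size A * size B)%:R.
pose t := 1 + n.
have n0 : 0 <= n by rewrite ler0n.
have t0 : 0 < t by rewrite ltr_wpDr.
(* [c1] is the constant of [l2_norm_le] for the pointwise factor [size A * t] of [le_regular_repr];
   [c2] is the loss in the Sobolev norm. *)
pose c1 := Num.sqrt ((size A)%:R * ((size A)%:R * t) ^+ 2).
pose c2 : R := Num.sqrt (size A * (size A * size B))%:R.
have c10 : 0 <= c1 by exact: sqrtr_ge0.
have c20 : 0 <= c2 by exact: sqrtr_ge0.
(* The summand 1 secures positivity of the constant without examining whether [c1] or [c2]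
   vanishes. *)
exists (1 + c1 * C * c2), s; split=> //.
  by rewrite ltr_wpDr // !mulr_ge0 // ltW.
move=> f fK; have [fKK _] := fK.
set u := fun x => normc (f x).
have u0 x : 0 <= u x by exact: normc_ge0.
have uKl k x : k \in K -> u (k * x)%g = u x.
  by move=> kK; rewrite /u -[(k * x)%g]mulg1 fKK ?gpred1.
have uKr k x : k \in K -> u (x * k)%g = u x.
  by move=> kK; rewrite /u -[x in LHS]mul1g fKK ?gpred1.
pose F := cover_bimax A u.
have FH := cover_bimax_hecke Acov Bcov Kan fK.
have [FHH _] := FH.
have [S FS] := hecke_algebra_support Han FH.
have F0 x : 0 <= F x by exact: cover_max_ge0.
apply: ge_ereal_sup => _ [xi [[xiK xi_fin] xi1] <-].
(* [op_norm] is a supremum over the unit ball, so the dominating function is scaled into it. *)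
pose X x := t^-1 * cover_max A (fun a => normc (xi (a * x)%g)).
have X0 x : 0 <= X x by rewrite mulr_ge0 ?cover_max_ge0 // invr_ge0 ltW.
have xiKn k x : k \in K -> normc (xi (k * x)%g) = normc (xi x).
  by move=> kK; rewrite xiK.
have XH h x : h \in H -> X (h * x)%g = X x.
  move=> hH; rewrite /X; congr (_ * _).
  rewrite -(cover_max_translate Acov (u := fun a => normc (xi (a * x)%g)) _ hH).
    by apply: eq_bigr => a _; rewrite mulgA.
  by move=> k y kK; rewrite -mulgA (xiKn k).
pose Fc x := (F x)%:C; pose Xc x := (X x)%:C.
have sobF : (sobolev_norm H L s Fc <= c2%:E * sobolev_norm K L s f)%E.
  exact: (sobolev_norm_cover_bimax Acov Bcov).
have X1 : (l2_norm H Xc <= 1)%E.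
  have -> : 1%E = sqrte 1%E :> \bar R by rewrite /sqrte sqrtr1.
  rewrite lee_sqrt //.
  have : (sum_rcosets K (fun x => (normc (xi x) ^+ 2)%:E) <= 1)%E.
    by move: xi1; rewrite (_ : 1%E = sqrte 1%E :> \bar R) ?lee_sqrt // /sqrte sqrtr1.
  move=> xi1'.
  pose m x := cover_max A (fun a => normc (xi (a * x)%g)).
  apply: (@le_trans _ _ (sum_rcosets H (fun x => (t^-1 ^+ 2)%:E * (m x ^+ 2)%:E)%E)).
    rewrite -[leLHS]/(sum_rcosets H (fun x => (normc (Xc x) ^+ 2)%:E)).
    apply: le_sum_rcosets => x.
    by rewrite normc_real ger0_norm // /X exprMn EFinM.
  apply: (le_trans (sum_rcosetsZ _ _ _)); rewrite ?sqr_ge0 //.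
    by move=> x; rewrite lee_fin sqr_ge0.
  have := sum_rcosets_cover_max_sqr Acov Bcov (fun x => normc_ge0 (xi x)) xiKn.
  rewrite -/n => mn.
  apply: (@le_trans _ _ ((t^-1 ^+ 2)%:E * (n%:E * 1))%E).
    rewrite lee_wpmul2l ?lee_fin ?sqr_ge0 // (le_trans mn) //.
    by rewrite lee_wpmul2l ?lee_fin.
  (* What remains is [n <= (1 + n) ^+ 2]. *)
  rewrite mule1 -EFinM lee_fin exprVn ler_pdivrMl ?exprn_gt0 // mulr1.
  rewrite /t sqrrD expr1n mul1r mulr2n.
  by nra.
have XL2 : l2 H Xc.
  split; first by move=> h x hH; rewrite /Xc XH.
  by rewrite (le_lt_trans X1) ?ltry.
have op : (l2_norm H (regular_repr H Fc Xc) <= op_norm H (regular_repr H Fc))%E.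
  by apply: ereal_sup_ubound; exists Xc.
have le1 : (l2_norm K (regular_repr K f xi) <= c1%:E * l2_norm H (regular_repr H Fc Xc))%E.
  apply: (l2_norm_le Acov); first by rewrite mulr_ge0 // ltW.
    move=> g; apply: (@le_regular_repr H K A Acov f xi F X t g S) => //.
    - exact: ltW.
    - by move=> x; exact: (le_cover_bimax Acov uKl uKr).
    - move=> x; rewrite /X mulVKf ?gt_eqF //.
      have := @le_cover_max H K A (fun a => normc (xi (a * x)%g)) 1%g Acov _ gpred1.
      by rewrite mul1g; apply => k y kK; rewrite -mulgA (xiKn k).
    - by move=> h x k hH kH; rewrite /F (cover_bimax_biinvariant Acov uKl uKr).
    - by move=> x Fx; apply: FS; rewrite fmorph_eq0.
  by move=> h x hH; apply: regular_repr_left_invariant.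
apply: (le_trans le1).
have sob0 : (0 <= sobolev_norm K L s f)%E by exact: sqrte_ge0.
apply: (@le_trans _ _ (c1%:E * (C%:E * (c2%:E * sobolev_norm K L s f)))%E).
  rewrite lee_wpmul2l ?lee_fin // (le_trans op) // (le_trans (RD _ FH)) //.
  by rewrite lee_wpmul2l ?lee_fin // ltW.
by rewrite !muleA -!EFinM lee_wpmul2r // lee_fin lerDr.
Qed.

End Cosets.

Theorem theorem2p2 (R : realType) (G : groupType) (H K : groupClosed G)
    (L : G -> R) :
  strongly_commensurable H K -> almost_normal H -> almost_normal K ->
  length_function L ->
  [set` H] `<=` length_kernel L -> [set` K] `<=` length_kernel L ->
  (property_RD H L <-> property_RD K L).
Proof.
move=> HK Han Kan Llen LH LK; split; first exact: property_RD_transfer.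
apply: property_RD_transfer => //; have [finH finK] := HK.
have predIC : [predI K & H] = [predI H & K] :> {pred G}.
  by apply/funext => x; rewrite /= andbC.
by rewrite /strongly_commensurable predIC.
Qed.
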